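(* Let $G_1$ be a graph with some odd cycle and let $G_2$ be a non-trivial bounded graph without odd cycles. Assume that $G_1$ satisfies the following property: for each $M>0$ there exist a geodesic $g$ in $G_1$ joining two minimal cycles of $G_1$ and a vertex $u\in g\cap V(G_1)$ with $d_{G_1}\big(u,\mathfrak{C}(G_1)\big)\ge M$. Then the direct product $G_1\times G_2$ is not hyperbolic.
   Context: Conventions. A graph $G$ (such as $G_1,G_2$) is a nonempty, connected, simple (no loops, no multiple edges), possibly infinite graph; every edge has length $1$, and $G$ is regarded as a geodesic metric space by identifying each edge isometrically with $[0,1]$ and using the shortest-path distance $d_G$ (so points of $G$ are vertices and interior points of edges). A graph is trivial if it has exactly one vertex, and bounded if it has finite diameter. A cycle is a simple closed curve (a closed path with no repeated vertices except first = last); it is odd if its length is odd. $L$ denotes length. A $u,v$-walk is a path joining $u$ and $v$ in which repeated vertices are allowed. Minimal cycles: a $u,v$-walk $g$ in $G$ is a shortcut of a cycle $C$ if $g\cap C=\{u,v\}$ and $L(g)<d_C(u,v)$, where $d_C$ is the length metric on $C$. A cycle $C'$ is a reduction of the cycle $C$ if both have odd length and $C'$ is the union of a subarc $\eta$ of $C$ and a shortcut of $C$ joining the endpoints of $\eta$. A cycle is minimal if it has odd length and has no reduction. $\mathfrak{C}(G)$ denotes the set of minimal cycles of $G$, and $d_G(u,\mathfrak{C}(G)):=\inf\{d_G(u,C): C\in\mathfrak{C}(G)\}$. Direct product: $G_1\times G_2$ has vertex set $V(G_1)\times V(G_2)$, and $(u_1,v_1)$, $(u_2,v_2)$ are adjacent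 iff $[u_1,u_2]\in E(G_1)$ and $[v_1,v_2]\in E(G_2)$. Hyperbolicity: in a geodesic metric space $X$, a geodesic triangle is the union of three geodesics $[x_1x_2],[x_2x_3],[x_3x_1]$; it is $\delta$-thin if each side is contained in the $\delta$-neighborhood of the union of the other two sides. $\delta(T)$ is the infimum of $\delta\ge 0$ such that $T$ is $\delta$-thin, $\delta(X):=\sup_T\delta(T)$ over all geodesic triangles $T$ in $X$, and $X$ is hyperbolic if $\delta(X)<\infty$. If $X$ has connected components $X_i$, then $\delta(X):=\sup_i\delta(X_i)$, and $X$ is hyperbolic if $\delta(X)<\infty$. *)

(* Defs.v *)
From HB Require Import structures.
From mathcomp Require Import all_boot all_order all_algebra.
From mathcomp Require Import all_classical all_reals ereal.

Set Implicit Arguments.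
Unset Strict Implicit.
Unset Printing Implicit Defensive.

Import Order.TTheory GRing.Theory Num.Theory.

Local Open Scope classical_set_scope.
Local Open Scope ring_scope.
Local Open Scope ereal_scope.

Section Hyperbolicity.
Context {R : realType} {X : Type}.
Variable d : X -> X -> \bar R.

Definition set_dist (x : X) (A : set X) : \bar R :=
  ereal_inf [set d x y | y in A].

(* The values of [gam] outside [0, L] are irrelevant. *)
Definition is_geodesic (x y : X) (S : set X) : Prop :=
  exists (L : R) (gam : R -> X),
    [/\ (0 <= L)%R, gam 0%R = x, gam L = y,
        (forall s t : R, (0 <= s <= L)%R -> (0 <= t <= L)%R ->
           d (gam s) (gam t) = (`|s - t|%R)%:E)
      & S = gam @` [set t : R | (0 <= t <= L)%R]].

Definition geodesic_triangle (S1 S2 S3 : set X) : Prop :=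
  exists x1 x2 x3 : X,
    [/\ is_geodesic x1 x2 S1, is_geodesic x2 x3 S2 & is_geodesic x3 x1 S3].

Definition neighborhood (delta : R) (A : set X) : set X :=
  [set x | set_dist x A <= delta%:E].

Definition thin (delta : R) (S1 S2 S3 : set X) : Prop :=
  [/\ S1 `<=` neighborhood delta (S2 `|` S3),
      S2 `<=` neighborhood delta (S3 `|` S1)
    & S3 `<=` neighborhood delta (S1 `|` S2)].

Definition delta_triangle (S1 S2 S3 : set X) : \bar R :=
  ereal_inf [set delta%:E |
    delta in [set delta : R | (0 <= delta)%R /\ thin delta S1 S2 S3]].

Definition delta_on (A : set X) : \bar R :=
  ereal_sup [set e : \bar R | exists S1 S2 S3 : set X,
    [/\ geodesic_triangle S1 S2 S3, S1 `|` S2 `|` S3 `<=` A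
      & e = delta_triangle S1 S2 S3]].

(* For the metric graphs below, the connected component of [x] is the set of
   the points at finite distance from [x]. *)
Definition component (x : X) : set X := [set y | d x y < +oo].

Definition delta_hyp : \bar R := ereal_sup [set delta_on (component x) | x in setT].

Definition hyperbolic : Prop := delta_hyp < +oo.

Definition diameter : \bar R :=
  ereal_sup [set e : \bar R | exists x y : X, e = d x y].

End Hyperbolicity.

Record sgraph := SGraph {
  vert :> choiceType;
  adj : rel vert;
  adj_sym : symmetric adj;
  adj_irr : irreflexive adj }.

Arguments adj {s}.

(* The list [p] is the walk [u :: p] without its first vertex, so that its
   length is [size p]. *)
Definition is_walk (G : sgraph) (u v : G) (p : seq G) : Prop :=
  path adj u p /\ last u p = v.

Definition connected_graph (G : sgraph) : Prop :=
  inhabited G /\ forall u v : G, exists p, is_walk u v p.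

Definition trivial_graph (G : sgraph) : Prop := exists u : G, forall v : G, v = u.

(* A cycle is the cyclic sequence of its vertices; its length is [size c]. *)
Definition is_cycle (G : sgraph) (c : seq G) : Prop :=
  ucycle adj c /\ (2 < size c)%N.

Definition odd_cycle (G : sgraph) (c : seq G) : Prop :=
  is_cycle c /\ odd (size c).

Section DirectProduct.
Variables G1 G2 : sgraph.

Definition dprod_adj : rel (G1 * G2)%type :=
  [rel x y | adj x.1 y.1 && adj x.2 y.2].

Lemma dprod_adj_sym : symmetric dprod_adj.
Proof. by move=> x y; rewrite /dprod_adj /= adj_sym [in X in _ && X]adj_sym. Qed.

Lemma dprod_adj_irr : irreflexive dprod_adj.
Proof. by move=> x; rewrite /dprod_adj /= adj_irr. Qed.

Definition direct_product : sgraph := SGraph dprod_adj_sym dprod_adj_irr.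

End DirectProduct.

Section MetricGraph.
Context {R : realType} {G : sgraph}.

(* Points are given by barycentric coordinates: [on_edge a b t] is the point
   at distance [t] from [a] on the edge [a, b], or the vertex [a] if
   [a = b]. *)
Definition on_edge (a b : G) (t : R) : G -> R :=
  fun w => ((1 - t) *+ (w == a) + t *+ (w == b))%R.

Definition edge_coord (a b : G) (t : R) (f : G -> R) : Prop :=
  [/\ a = b \/ adj a b, (0 <= t <= 1)%R & f = on_edge a b t].

End MetricGraph.

Record gpoint (R : realType) (G : sgraph) := GPoint {
  bary : G -> R;
  baryP : exists (a b : G) (t : R), edge_coord a b t bary }.

Section MetricGraphTheory.
Context {R : realType} {G : sgraph}.

Lemma vtx_subproof (u : G) :
  exists (a b : G) (t : R), edge_coord a b t (on_edge u u (0 : R)%R).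
Proof. by exists u, u, 0%R; split=> //; [left | rewrite lexx ler01]. Qed.

Definition vtx (u : G) : gpoint R G := GPoint (vtx_subproof u).

(* A shortest path from [x] to [y] either stays on an edge containing both
   points, or runs from [x] to an end [a] of its edge, follows a walk from [a]
   to an end [b] of the edge of [y], and then runs from [b] to [y]. *)
Definition path_length (x y : gpoint R G) (l : R) : Prop :=
  (exists (a b : G) (s t : R),
     [/\ edge_coord a b s (bary x), edge_coord a b t (bary y)
       & l = `|s - t|%R])
  \/
  (exists (a a' b b' : G) (s t : R) (p : seq G),
     [/\ edge_coord a a' s (bary x), edge_coord b b' t (bary y),
         is_walk a b p & l = (s + (size p)%:R + t)%R]).

(* The distance is [+oo] between distinct connected components. *)
Definition gdist (x y : gpoint R G) : \bar R :=
  ereal_inf [set l%:E | l in path_length x y].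

Definition segment (a b : G) : set (gpoint R G) :=
  [set x | exists t : R, edge_coord a b t (bary x)].

Fixpoint walk_points (u : G) (p : seq G) : set (gpoint R G) :=
  if p is v :: q then segment u v `|` walk_points v q else [set vtx u].

Definition cycle_points (c : seq G) : set (gpoint R G) :=
  if c is u :: p then walk_points u (rcons p u) else set0.

End MetricGraphTheory.

Definition bounded_graph (R : realType) (G : sgraph) : Prop :=
  diameter (@gdist R G) < +oo.

Section MinimalCycles.
Variable R : realType.
Context {G : sgraph}.
Implicit Types (u v : G) (c p : seq G).

(* [arc c u v] lists the vertices of [c] from [u] on, up to and excluding
   [v]; its size is the length of this arc. *)
Definition cycle_dist c u v : nat := minn (size (arc c u v)) (size (arc c v u)).

Definition shortcut c u v p : Prop :=
  [/\ is_walk u v p,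
      walk_points u p `&` cycle_points c = [set vtx u; vtx v] :> set (gpoint R G)
    & (size p < cycle_dist c u v)%N].

Definition subarc c u v : set (set (gpoint R G)) :=
  [set eta | eta = walk_points u (rcons (behead (arc c u v)) v) \/
             eta = walk_points v (rcons (behead (arc c v u)) u)].

(* A shortcut has distinct endpoints, so no degenerate subarc occurs here. *)
Definition reduction c c' : Prop :=
  [/\ odd_cycle c, odd_cycle c' &
      exists u v p (eta : set (gpoint R G)),
        [/\ shortcut c u v p, subarc c u v eta
          & cycle_points c' = eta `|` walk_points u p]].

Definition minimal_cycle c : Prop :=
  odd_cycle c /\ ~ exists c', reduction c c'.

Definition dist_minimal (x : gpoint R G) : \bar R :=
  ereal_inf [set set_dist gdist x (cycle_points c) | c in minimal_cycle].

End MinimalCycles.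

Arguments vtx R {G} u.
Arguments gdist R G : clear implicits.
Arguments cycle_points R {G} c.

(* Main.v *)
Require Import Defs.
From mathcomp Require Import all_boot all_order all_algebra.
From mathcomp Require Import all_classical all_reals ereal.
From mathcomp Require Import zify lra.

(* Write H for the product and fix an edge v0 v1 of G2. Alternating between v0
   and v1 lifts every walk of G1 to H, and geodesics of G1 lift to geodesics of
   H; as G2 has no odd closed walk, the two lifts of a vertex u of G1 are as far
   apart as the shortest odd closed walk through u is long. Suppose that
   geodesic triangles, hence polygons, of H are uniformly thin.
   - A minimal cycle C of length 2k+1 is isometrically embedded, so going twice
     around it lifts to a closed geodesic pentagon. If k is large, the midpoint
     of a side of length k can only be close to its other lift. So every vertex
     of a minimal cycle, long or short, is on a short odd closed walk.
   - If this holds at both ends of a geodesic of G1, its two lifts span a thin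
     quadrilateral, and it holds along the whole geodesic.
   - A vertex on a short odd closed walk is close to an odd cycle, and then,
     since reductions shrink cycles and meet them, to a minimal cycle. *)

Set Implicit Arguments.
Unset Strict Implicit.
Unset Printing Implicit Defensive.

Import Order.TTheory GRing.Theory Num.Theory.

Local Open Scope classical_set_scope.

(** * Discrete geodesics and odd closed walks *)

Section Walks.
Context {G : sgraph}.
Implicit Types (u v w : G) (p q : seq G).

Definition walkn (n : nat) u v : Prop := exists2 p, is_walk u v p & size p = n.

Lemma walkn_refl u : walkn 0 u u.
Proof. by exists [::]. Qed.

Lemma walkn_adj u v : adj u v -> walkn 1 u v.
Proof. by move=> uv; exists [:: v] => //; split=> //=; rewrite uv. Qed.

Lemma walkn_cat m n u v w : walkn m u v -> walkn n v w -> walkn (m + n) u w.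
Proof.
move=> [p [pp <-] <-] [q [qp <-] <-]; exists (p ++ q); last by rewrite size_cat.
by split; rewrite ?last_cat// cat_path pp.
Qed.

Lemma is_walk_rev u v p : is_walk u v p ->
  is_walk v u (rev (belast u p)).
Proof.
move=> [pp <-]; split.
  by rewrite rev_path; under eq_path => x y do rewrite adj_sym.
by case: p {pp} => //= x p; rewrite rev_cons last_rcons.
Qed.

Lemma walkn_sym n u v : walkn n u v -> walkn n v u.
Proof.
move=> [p /is_walk_rev wp <-]; exists (rev (belast u p)) => //.
by rewrite size_rev size_belast.
Qed.

Lemma walkn_fun (f : nat -> G) n i j :
  (forall i, i < n -> adj (f i) (f i.+1)) -> i <= j -> j <= n ->
  walkn (j - i) (f i) (f j).
Proof.
move=> fadj /subnKC <-; rewrite addKn; elim: (j - i) => [|m IHm] le_n.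
  by rewrite addn0; exact: walkn_refl.
rewrite addnS in le_n *; rewrite -addn1; apply: (walkn_cat (IHm (ltnW le_n))).
exact/walkn_adj/fadj.
Qed.

Lemma walkn_le1 u v : u = v \/ adj u v -> exists2 l, l <= 1 & walkn l u v.
Proof.
by case=> [<-|/walkn_adj]; [exists 0; rewrite //; exact: walkn_refl|exists 1].
Qed.

(** Minimality is tested against the lengths of all walks, which takes the place of a distance
    function on vertices. Only the vertex set is kept, so the direction of travel does not
    matter. *)
Definition gpath u v (S : set G) : Prop :=
  exists (f : nat -> G) (n : nat),
    [/\ f 0 = u, f n = v, forall i, i < n -> adj (f i) (f i.+1),
        forall i j l, i <= j -> j <= n -> walkn l (f i) (f j) -> j - i <= l
      & S = [set z | exists2 i, i <= n & f i = z]].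

Lemma gpath_sym u v S : gpath u v S -> gpath v u S.
Proof.
move=> [f [n [f0 fn fadj fgeo ->]]]; exists (fun i => f (n - i)), n.
split; rewrite ?subn0 ?subnn//.
- by move=> i lt_in; rewrite adj_sym subnS -[n - i]prednK ?subn_gt0//; apply: fadj; lia.
- move=> i j l ij jn /walkn_sym /fgeo; lia.
- apply/seteqP; split=> z [i lein <-]; exists (n - i); rewrite ?leq_subr//.
  by rewrite subKn.
Qed.

(** Replacing the stretch from [f i] to [f j] by a shorter walk would shorten the whole walk. *)
Lemma shortest_walk_geodesic u v p (f := nth u (u :: p)) :
  is_walk u v p -> (forall l, walkn l u v -> size p <= l) ->
  [/\ f (size p) = v, forall i, i < size p -> adj (f i) (f i.+1)
    & forall i j l, i <= j -> j <= size p -> walkn l (f i) (f j) -> j - i <= l].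
Proof.
move=> [pp lp] minp.
have fadj i : i < size p -> adj (f i) (f i.+1) by move: i; exact/pathP.
have fv : f (size p) = v by rewrite /f -[size p]/(size (u :: p)).-1 nth_last.
split=> // i j l ij jp wl.
have w1 : walkn (i - 0) u (f i) by apply: (walkn_fun fadj); lia.
have w2 := walkn_fun fadj jp (leqnn _); rewrite fv in w2.
by have := minp _ (walkn_cat (walkn_cat w1 wl) w2); lia.
Qed.

Lemma gpath_exists n u v : walkn n u v -> exists S, gpath u v S.
Proof.
move=> wuv; have ex : exists n, `[< walkn n u v >] by exists n; apply/asboolP.
case: (ex_minnP ex) => m /asboolP [p wp szp] minm.
have minp l : walkn l u v -> size p <= l.
  by move=> wl; rewrite szp; apply/minm/asboolP.
have [fv fadj fgeo] := shortest_walk_geodesic wp minp.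
by eexists; exists (nth u (u :: p)), (size p); split.
Qed.

Lemma gpath_walkn u v S : gpath u v S -> exists n, walkn n u v.
Proof.
move=> [f [n [<- <- fadj _ _]]]; exists (n - 0).
exact: (walkn_fun fadj).
Qed.

Lemma gpath_walkn_ends u v S z l : gpath u v S -> S z -> walkn l u v ->
  exists2 k, k <= l & walkn k u z.
Proof.
move=> [f [n [<- <- fadj fgeo ->]]] [i lein <-] /fgeo.
rewrite subn0 => /(_ isT (leqnn n)) nl.
by exists (i - 0); [lia|exact: (walkn_fun fadj)].
Qed.

Definition near_set (k : nat) (z : G) (S : set G) : Prop :=
  exists z' l, [/\ S z', l <= k & walkn l z z'].

Lemma near_setU k m z (S T U : set G) : near_set k z (S `|` T) ->
  (forall z', T z' -> near_set m z' U) -> near_set (k + m) z (S `|` U).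
Proof.
move=> [z' [l [[Sz'|Tz'] lk wl]]] TU.
  by exists z', l; split; [left|lia|].
have [z2 [l2 [Uz2 l2m wl2]]] := TU _ Tz'.
by exists z2, (l + l2); split; [right|lia|exact: walkn_cat wl wl2].
Qed.

(** Only one side is tested; renaming the corners gives the other two. *)
Definition thin_triangles (K : nat) : Prop :=
  forall a b c P S T z, gpath a b P -> gpath a c S -> gpath c b T -> P z ->
    near_set K z (S `|` T).

Section Polygons.
Variable K : nat.
Hypothesis thinK : thin_triangles K.

(** The diagonal from [c] to [b] cuts the polygon into two triangles, each costing [K]. *)
Lemma thin_quadrilateral a b c d P S T U z :
  gpath a b P -> gpath a c S -> gpath c d T -> gpath d b U -> P z ->
  near_set (K + K) z (S `|` (T `|` U)).
Proof.
move=> gP gS gT gU Pz.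
have [[m wm] [n wn]] := (gpath_walkn gT, gpath_walkn gU).
have [Q gQ] := gpath_exists (walkn_cat wm wn).
apply: near_setU (thinK gP gS gQ Pz) _ => z'; exact: thinK gQ gT gU.
Qed.

Lemma thin_pentagon a b c d e P S T U V z :
  gpath a b P -> gpath a c S -> gpath c d T -> gpath d e U -> gpath e b V ->
  P z -> near_set (K + (K + K)) z (S `|` (T `|` (U `|` V))).
Proof.
move=> gP gS gT gU gV Pz.
have [[m wm] [n wn]] := (gpath_walkn gT, gpath_walkn gU).
have [l wl] := gpath_walkn gV.
have [Q gQ] := gpath_exists (walkn_cat (walkn_cat wm wn) wl).
apply: near_setU (thinK gP gS gQ Pz) _ => z'; exact: thin_quadrilateral gQ gT gU gV.
Qed.

End Polygons.

Definition odd_loop (k : nat) u : Prop :=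
  exists l, [/\ l <= k, odd l & walkn l u u].

Lemma odd_loop_walkn k l u v : odd_loop k u -> walkn l u v ->
  odd_loop (k + l.*2) v.
Proof.
move=> [m [mk om wm]] wl; exists (l + m + l); split; [lia|lia|].
exact: walkn_cat (walkn_cat (walkn_sym wl) wm) wl.
Qed.

(** A repeated vertex splits a closed walk into two shorter closed walks, one of which is odd.
    Without repetition the walk is itself a cycle, since length 1 would mean a loop of the graph. *)
Lemma odd_closed_walk_odd_cycle u p : is_walk u u p -> odd (size p) ->
  exists c w l, [/\ odd_cycle c, size c <= size p, w \in c, l <= size p
                  & walkn l u w].
Proof.
have [n] := ubnP (size p); elim: n u p => // n IHn u p szp [pp lp] op.
have [up|/negP nup] := boolP (uniq p).
  case: p szp pp lp op up => // x p szp pp lp op up.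
  have pc : cycle adj (x :: p) by rewrite (cycle_path u) lp.
  exists (x :: p), u, 0; split=> //; last exact: walkn_refl.
    split=> //; split; first by rewrite /ucycle pc.
    case: p op pp lp {szp up pc} => [|y [|]] //= _ /andP[+ _] xu.
    by rewrite xu adj_irr.
  by rewrite -{1}lp /= mem_last.
have [x [p1 [p2 [p3 pE]]]] : exists x p1 p2 p3, p = p1 ++ x :: p2 ++ x :: p3.
  elim: p {szp pp lp op} nup => // y p IHp /= /negP; rewrite negb_and negbK.
  case/orP => [yp|/negP /IHp[x [p1 [p2 [p3 ->]]]]].
    by case/splitPr: yp => p1 p2; exists y, [::], p1, p2.
  by exists x, (y :: p1), p2, p3.
have szE : size p = size (p1 ++ x :: p3) + size (rcons p2 x).
  by rewrite pE !size_cat/= !size_cat /= size_rcons; lia.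
move: pp; rewrite pE cat_path /= cat_path /= => /and5P[pp1 ax pp2 ax2 pp3].
have lp3 : last x p3 = u by rewrite -lp pE last_cat /= last_cat.
case: (boolP (odd (size (rcons p2 x)))) => [o2|e2].
- have [||c [w [l [oc szc wc lsz wl]]]] := IHn x (rcons p2 x) _ _ o2.
  + by rewrite szE size_cat /= in szp; lia.
  + by split; rewrite ?last_rcons// rcons_path pp2.
  exists c, w, (size p1 + 1 + l); rewrite -pE szE size_cat /=; split=> //; try lia.
  apply: walkn_cat wl; apply: (@walkn_cat _ _ _ (last u p1)); first by exists p1.
  exact: walkn_adj.
- have [|||c [w [l [oc szc wc lsz wl]]]] := IHn u (p1 ++ x :: p3).
  + by move: szp; rewrite szE size_rcons; lia.
  + by split; rewrite ?last_cat// cat_path /= pp1 ax.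
  + by move: op; rewrite szE oddD (negbTE e2) addbF.
  by exists c, w, l; split=> //; rewrite -pE szE; lia.
Qed.

End Walks.

(** * Points of a metric graph *)

Section MetricPoints.
Local Open Scope ring_scope.
Context {R : realType} {G : sgraph}.
Implicit Types (a b w : G) (x y : gpoint R G) (s t l : R).

Lemma gpoint_eq x y : bary x = bary y -> x = y.
Proof.
case: x y => [f fP] [g gP] /= fg; rewrite -fg in gP *.
by congr GPoint; exact: Prop_irrelevance.
Qed.

Lemma on_edge_sym a b t : on_edge a b t = on_edge b a (1 - t).
Proof. by apply/funext => w; rewrite /on_edge subKr addrC. Qed.

Lemma on_edge_refl a t : on_edge a a t = on_edge a a 0.
Proof. by apply/funext => w; rewrite /on_edge -!mulrnDl subrK subr0 addr0. Qed.

Lemma on_edge0 a b : on_edge a b 0 = on_edge a a (0 : R).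
Proof. by apply/funext => w; rewrite /on_edge !mul0rn. Qed.

Lemma on_edge1 a b : on_edge a b 1 = on_edge b b (0 : R).
Proof. by rewrite on_edge_sym subrr on_edge0. Qed.

Lemma edge_coord_sym a b t f : edge_coord a b t f -> edge_coord b a (1 - t) f.
Proof.
case=> ab tb ->; split; [|lra|exact: on_edge_sym].
by case: ab => [->|ab]; [left|right; rewrite adj_sym].
Qed.

Lemma edge_coord_vtx a : edge_coord a a 0 (bary (vtx R a)).
Proof. by split=> //; [left|rewrite lexx ler01]. Qed.

Lemma on_edge_support a b t w : on_edge a b t w != 0 -> w = a \/ w = b.
Proof.
rewrite /on_edge; have [->|_] := eqVneq w a; first by left.
have [->|_] := eqVneq w b; first by right.
by rewrite !mulr0n addr0 eqxx.
Qed.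

Lemma on_edge_supportl a b t : t != 1 -> on_edge a b t a != 0.
Proof.
move=> t1; rewrite /on_edge eqxx mulr1n.
case: (a == b); rewrite ?mulr1n ?mulr0n ?subrK ?oner_neq0//.
by rewrite addr0 subr_eq0 eq_sym.
Qed.

(** The vertices with nonzero coordinate depend only on the point, not on the edge chosen to
    represent it. They serve to compare two representations. *)
Lemma edge_coord_support a b t f : edge_coord a b t f ->
  exists2 w, w = a \/ w = b & f w != 0.
Proof.
case=> _ _ ->; have [->|t1] := eqVneq t 1.
  by exists b; [right|rewrite on_edge1 on_edge_supportl// eq_sym oner_neq0].
by exists a; [left|exact: on_edge_supportl].
Qed.

Lemma edge_coord_near a b t f w : edge_coord a b t f -> f w != 0 ->
  exists2 l : nat, (l <= 1)%N & walkn l a w.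
Proof.
move=> [ab _ ->] /on_edge_support [->|->]; last exact: walkn_le1.
by exists 0%N; last exact: walkn_refl.
Qed.

Lemma edge_coord_walkn a b s a' b' t f :
  edge_coord a b s f -> edge_coord a' b' t f ->
  exists2 l : nat, (l <= 2)%N & walkn l a a'.
Proof.
move=> ec ec'; have [w _ fw] := edge_coord_support ec.
have [[l l1 wl] [l' l1' wl']] := (edge_coord_near ec fw, edge_coord_near ec' fw).
by exists (l + l')%N; [lia|exact: walkn_cat wl (walkn_sym wl')].
Qed.

(** The path may use other representations of [x] and [y] than the given ones; changing
    representation costs at most 2 at each end. *)
Lemma path_length_walkn x y l a b s a' b' t :
  edge_coord a b s (bary x) -> edge_coord a' b' t (bary y) ->
  path_length x y l -> exists2 n : nat, n%:R <= l + 4 & walkn n a a'.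
Proof.
move=> ex ey [[c [d [s' [t' [ex' ey' ->]]]]]|].
  have [m m2 wm] := edge_coord_walkn ex ex'.
  have [n n2 wn] := edge_coord_walkn ey' ey.
  exists (m + n)%N; last exact: walkn_cat wm wn.
  have : (m + n <= 4)%N by lia.
  by rewrite -(ler_nat R); move: (normr_ge0 (s' - t')); lra.
move=> [c [c' [d [d' [s' [t' [p [ex' ey' wp ->]]]]]]]].
have [m m2 wm] := edge_coord_walkn ex ex'.
have [n n2 wn] := edge_coord_walkn ey' ey.
exists (m + size p + n)%N; last first.
  by apply: walkn_cat wn; apply: walkn_cat wm _; exists p.
have : (m + size p + n <= size p + 4)%N by lia.
rewrite -(ler_nat R) natrD.
by case: ex' => _ ? _; case: ey' => _ ? _; lra.
Qed.

Lemma edge_coord_sum (phi : G -> R) a b t (r : seq G) :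
  uniq r -> a \in r -> b \in r ->
  \sum_(w <- r) on_edge a b t w * phi w = (1 - t) * phi a + t * phi b.
Proof.
move=> ur ar br; rewrite /on_edge; under eq_bigr do rewrite mulrDl !mulrnAl.
rewrite big_split /=; congr (_ + _).
- rewrite (bigD1_seq a)//= eqxx mulr1n big1 ?addr0// => w /negPf ->.
  by rewrite mulr0n.
- rewrite (bigD1_seq b)//= eqxx mulr1n big1 ?addr0// => w /negPf ->.
  by rewrite mulr0n.
Qed.

(** The affine extension of [phi] to the edges is well defined: its value is the sum of [phi]
    weighted by the barycentric coordinates. *)
Lemma edge_coord_affine (phi : G -> R) a b s a' b' t f :
  edge_coord a b s f -> edge_coord a' b' t f ->
  (1 - s) * phi a + s * phi b = (1 - t) * phi a' + t * phi b'.
Proof.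
move=> [_ _ fE] [_ _ fE']; pose r := undup [:: a; b; a'; b'].
rewrite -!(@edge_coord_sum _ _ _ _ r) ?undup_uniq// ?mem_undup ?inE ?eqxx ?orbT//.
by rewrite -fE -fE'.
Qed.

Section Lipschitz.
Variable phi : G -> R.
Hypothesis phi_lip : forall a b, adj a b -> `|phi a - phi b| <= 1.

Lemma walk_lipschitz a b p : is_walk a b p -> `|phi a - phi b| <= (size p)%:R.
Proof.
elim: p a b => [|c p IHp] a _ [/= pp <-]; first by rewrite subrr normr0.
case/andP: pp => ac pp; have := IHp c _ (conj pp erefl).
have := ler_distD (phi c) (phi a) (phi (last c p)); have := phi_lip ac.
by rewrite -natr1; lra.
Qed.

Lemma edge_lipschitz a b : a = b \/ adj a b -> `|phi a - phi b| <= 1.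
Proof. by case=> [->|/phi_lip//]; rewrite subrr normr0 ler01. Qed.

(** This is the source of lower bounds on [gdist]: the affine extension of a 1-Lipschitz function on
    vertices varies by at most the length of any path. *)
Lemma path_length_lipschitz x y l a b s a' b' t :
  edge_coord a b s (bary x) -> edge_coord a' b' t (bary y) ->
  path_length x y l ->
  `|((1 - s) * phi a + s * phi b) - ((1 - t) * phi a' + t * phi b')| <= l.
Proof.
move=> ex ey [[c [d [s' [t' [ex' ey' ->]]]]]|].
  rewrite (edge_coord_affine phi ex ex') (edge_coord_affine phi ey ey').
  have -> : ((1 - s') * phi c + s' * phi d) - ((1 - t') * phi c + t' * phi d)
    = (t' - s') * (phi c - phi d) by lra.
  rewrite normrM distrC ler_piMr//; apply: edge_lipschitz.
  by case: ex'.
move=> [c [c' [d [d' [s' [t' [p [ex' ey' wp ->]]]]]]]].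
rewrite (edge_coord_affine phi ex ex') (edge_coord_affine phi ey ey').
have lip e e' r f : edge_coord e e' r f ->
    `|(1 - r) * phi e + r * phi e' - phi e| <= r.
  move=> [/edge_lipschitz ee' r01 _].
  have -> : (1 - r) * phi e + r * phi e' - phi e = - (r * (phi e - phi e')) by lra.
  rewrite normrN normrM ger0_norm; last lra.
  by rewrite ler_piMr//; lra.
have := lip _ _ _ _ ex'; have := lip _ _ _ _ ey'; have := walk_lipschitz wp.
rewrite !ler_norml; lra.
Qed.

End Lipschitz.

Lemma path_length_sym x y l : path_length x y l -> path_length y x l.
Proof.
case=> [[a [b [s [t [ex ey ->]]]]]|[a [a' [b [b' [s [t [p [ex ey wp ->]]]]]]]]].
  by left; exists a, b, t, s; split=> //; exact: distrC.
right; exists b, b', a, a', t, s, (rev (belast a p)); split=> //.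
  exact: is_walk_rev.
by rewrite size_rev size_belast; lra.
Qed.

Lemma gdist_sym x y : gdist R G x y = gdist R G y x.
Proof.
rewrite /gdist; congr ereal_inf; apply/seteqP.
by split=> _ [l /path_length_sym xy <-]; exists l.
Qed.

Lemma gdist_le x y l : path_length x y l -> (gdist R G x y <= l%:E)%E.
Proof. by move=> xy; apply: ereal_inf_lbound; exists l. Qed.

Lemma gdist_lt x y l : (gdist R G x y < l%:E)%E ->
  exists2 l', path_length x y l' & l' < l.
Proof. by move=> /ereal_inf_lt [_ [l' xy <-]]; rewrite lte_fin; exists l'. Qed.

Lemma gdist_vtx n a b : walkn n a b -> (gdist R G (vtx R a) (vtx R b) <= n%:R%:E)%E.
Proof.
move=> [p wp <-]; apply: gdist_le; right; exists a, a, b, b, 0, 0, p.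
by split=> //; [exact: edge_coord_vtx|exact: edge_coord_vtx|lra].
Qed.

End MetricPoints.

(** * From metric to discrete thin triangles *)

Section Hyperbolic.
Local Open Scope ring_scope.
Context {R : realType} {X : Type} (d : X -> X -> \bar R).

Lemma is_geodesic_sym x y S : is_geodesic d x y S -> is_geodesic d y x S.
Proof.
move=> [L [gam [L0 g0 gL giso ->]]]; exists L, (fun t => gam (L - t)).
split; rewrite ?subr0 ?subrr//.
  move=> s t sb tb; rewrite giso; [|lra|lra].
  by rewrite distrC; congr (`|_|%:E); lra.
apply/seteqP; split=> _ [t /= tb <-].
  by exists (L - t) => /=; [lra|rewrite subKr].
by exists (L - t) => //=; lra.
Qed.

(** Taking [D] strictly above the supremum ensures that some constant below [D] actually makes the
    given triangle thin, although [delta_triangle] is only an infimum. *)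
Lemma hyperbolic_thin : hyperbolic d ->
  exists D : R, forall S1 S2 S3 x, geodesic_triangle d S1 S2 S3 ->
    S1 `|` S2 `|` S3 `<=` component d x -> thin d D S1 S2 S3.
Proof.
move=> hyp; have [D hypD] : exists D : R, (delta_hyp d < D%:E)%E.
  move: hyp; rewrite /hyperbolic; case: (delta_hyp d) => [r _||_] //.
    by exists (r + 1); rewrite lte_fin ltrDl.
  by exists 0; rewrite ltNyr.
exists D => S1 S2 S3 x tri sub.
have : (delta_triangle d S1 S2 S3 < D%:E)%E.
  apply: le_lt_trans hypD; apply: (@le_trans _ _ (delta_on d (component d x))).
    by apply: ereal_sup_ubound; exists S1, S2, S3.
  by apply: ereal_sup_ubound; exists x.
move=> /ereal_inf_lt [_ [e [_ [t1 t2 t3]] <-]]; rewrite lte_fin => /ltW eD.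
by split=> [z /t1|z /t2|z /t3] /le_trans; apply; rewrite lee_fin.
Qed.

End Hyperbolic.

Section Realization.
Context {R : realType} {G : sgraph}.

(* Distance to the initial vertex of a geodesic, truncated at its length so as
   to be total. *)
Lemma gpath_potential (f : nat -> G) n :
  (forall i j l, i <= j -> j <= n -> walkn l (f i) (f j) -> j - i <= l) ->
  (forall i, i < n -> adj (f i) (f i.+1)) ->
  exists phi : G -> nat, (forall u v, adj u v -> phi v <= (phi u).+1) /\
    forall i, i <= n -> phi (f i) = i.
Proof.
move=> fgeo fadj.
have ex w : exists k, (k == n) || `[< walkn k (f 0) w >] by exists n; rewrite eqxx.
exists (fun w => ex_minn (ex w)); split=> [u v uv|i lein].
  case: ex_minnP => k _ mink; case: ex_minnP => m /orP[/eqP ->|/asboolP wm] minm.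
    by apply: leqW; apply: mink; rewrite eqxx.
  apply: mink; apply/orP; right; apply/asboolP; rewrite -addn1.
  exact: walkn_cat wm (walkn_adj uv).
case: ex_minnP => k kP mink; apply/eqP; rewrite eqn_leq mink; last first.
  apply/orP; right; apply/asboolP; rewrite -{1}[i]subn0.
  exact: (walkn_fun fadj).
case/orP: kP => [/eqP ->//|/asboolP /fgeo]; rewrite subn0; exact.
Qed.

(** The geodesic is traversed at unit speed. Explicit paths bound distances along it from above, and
    the potential [phi] bounds them from below. *)
Lemma gpath_realization (a b : G) S : gpath a b S ->
  exists T : set (gpoint R G),
    [/\ is_geodesic (gdist R G) (vtx R a) (vtx R b) T,
        forall z, S z -> T (vtx R z)
      & forall x, T x -> exists c c' t, S c /\ edge_coord c c' t (bary x)].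
Proof.
move=> [f [n [f0 fn fadj fgeo SE]]].
have [phi [phi_lip phif]] := gpath_potential fgeo fadj.
(* Freezing [f] after [n] gives time [n] a degenerate edge from [f n] to itself. *)
pose h i := f (minn i n).
have hadj i : h i = h i.+1 \/ adj (h i) (h i.+1).
  rewrite /h; case: (ltnP i n) => [lt_in|le_ni]; last first.
    by left; congr f; lia.
  by right; rewrite (minn_idPl lt_in); exact: fadj.
(* The absolute value makes the curve total; its values at negative times are irrelevant. *)
pose tr (t : R) : nat := Num.truncn `|t|%R.
have trb (t : R) : ((tr t)%:R <= `|t| < (tr t)%:R + 1)%R.
  by have := truncn_itv (normr_ge0 t); rewrite -natr1.
have ptP t : exists (a b : G) (s : R),
  edge_coord a b s (on_edge (h (tr t)) (h (tr t).+1) (`|t| - (tr t)%:R)%R).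
  exists (h (tr t)), (h (tr t).+1), (`|t| - (tr t)%:R)%R; split=> //.
  by have := trb t; lra.
pose gam t : gpoint R G := GPoint (ptP t).
have gamE t : (0 <= t)%R ->
    edge_coord (h (tr t)) (h (tr t).+1) (t - (tr t)%:R)%R (bary (gam t)).
  move=> t0; rewrite /gam /= (ger0_norm t0); split=> //.
  by have := trb t; rewrite ger0_norm//; lra.
have gam_nat i : i <= n -> gam i%:R%R = vtx R (f i).
  move=> lein; apply: gpoint_eq => /=; rewrite /tr normr_nat natrK subrr.
  by rewrite on_edge0 /h (minn_idPl lein).
have tr_le (t : R) : (0 <= t <= n%:R)%R -> tr t <= n.
  move=> tb; have := trb t; rewrite ger0_norm; last lra.
  move=> trt; rewrite -(ler_nat R); lra.
have gamD (s t : R) : (0 <= s <= n%:R)%R -> (0 <= t <= n%:R)%R -> (s <= t)%R ->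
    gdist R G (gam s) (gam t) = (`|s - t|%R)%:E.
  move=> sb tb st.
  have s0 : (0 <= s)%R by lra.
  have t0 : (0 <= t)%R by lra.
  have [es et] := (gamE _ s0, gamE _ t0).
  apply/eqP; rewrite eq_le; apply/andP; split.
    apply: gdist_le.
    have [bs bt] := (trb s, trb t); rewrite !ger0_norm// in bs bt.
    have le_tr : tr s <= tr t by apply: le_truncn; rewrite !ger0_norm.
    case: (ltnP (tr s) (tr t)) => [lt_tr|]; last first.
      move=> ge_tr; have trE : tr t = tr s by apply/eqP; rewrite eqn_leq ge_tr.
      rewrite trE in et; left; exists (h (tr s)), (h (tr s).+1).
      exists (s - (tr s)%:R)%R, (t - (tr s)%:R)%R; split=> //.
      by congr (`|_|)%R; lra.
    have [p wp szp] := walkn_fun fadj lt_tr (tr_le _ tb).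
    (* The path leaves [gam s] through the forward end of its edge, hence the reversed
       coordinate. *)
    right; exists (h (tr s).+1), (h (tr s)), (h (tr t)), (h (tr t).+1).
    exists (1 - (s - (tr s)%:R))%R, (t - (tr t)%:R)%R, p; split=> //.
    - exact: edge_coord_sym.
    - by rewrite /h (minn_idPl (tr_le _ tb)) (minn_idPl (leq_trans lt_tr (tr_le _ tb))).
    - rewrite szp natrB// -natr1 distrC ger0_norm; lra.
  (* For the lower bound, the extended potential takes the value [r] at [gam r]. *)
  apply: le_ereal_inf_tmp => _ [l /path_length_lipschitz pl <-]; rewrite lee_fin.
  have lip u v : adj u v -> (`|(phi u)%:R - (phi v)%:R : R| <= 1)%R.
    move=> uv; have := phi_lip _ _ uv; rewrite adj_sym in uv.
    have := phi_lip _ _ uv; rewrite -!(ler_nat R) -!natr1 ler_norml; lra.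
  move: (pl _ lip _ _ _ _ _ _ es et) => {pl}.
  have phih (r : R) : (0 <= r <= n%:R)%R ->
      ((1 - (r - (tr r)%:R)) * (phi (h (tr r)))%:R +
       (r - (tr r)%:R) * (phi (h (tr r).+1))%:R = r :> R)%R.
    move=> rb; have := trb r; rewrite ger0_norm; last lra.
    rewrite /h !phif ?geq_minr// (minn_idPl (tr_le _ rb)) => trr.
    case: (ltnP (tr r) n) => [lt_rn|le_nr].
      by rewrite (minn_idPl lt_rn) -natr1; lra.
    (* Here [r] is the final time [n]. *)
    have -> : ((tr r)%:R = r)%R.
      by move: le_nr; rewrite -(ler_nat R); lra.
    by rewrite subrr; lra.
  by rewrite !phih.
exists (gam @` [set t | (0 <= t <= n%:R)%R]); split.
- exists n%:R%R, gam; split=> //.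
  + by rewrite -[0%R]/(0%:R)%R gam_nat// f0.
  + by rewrite gam_nat// fn.
  + move=> s t sb tb; case: (leP s t) => st; first exact: gamD.
    by rewrite gdist_sym distrC; apply: gamD => //; exact: ltW.
- rewrite SE => _ [i lein <-]; exists i%:R%R; last exact: gam_nat.
  by rewrite /= ler0n ler_nat.
- move=> _ [t /= tb <-]; exists (h (tr t)), (h (tr t).+1), (t - (tr t)%:R)%R.
  split; last by apply: gamE; lra.
  by rewrite SE; exists (minn (tr t) n); rewrite ?geq_minr.
Qed.

Lemma gdist_vtx_lty (a c c' : G) t (x : gpoint R G) n :
  walkn n a c -> edge_coord c c' t (bary x) ->
  component (gdist R G) (vtx R a) x.
Proof.
move=> [p wp _] ex; apply: le_lt_trans (ltry (0 + (size p)%:R + t)).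
apply: gdist_le; right; exists a, a, c, c', 0%R, t, p; split=> //.
exact: edge_coord_vtx.
Qed.

Lemma gpath_walkn_mem (a b z : G) S : gpath a b S -> S z -> exists n, walkn n a z.
Proof.
move=> gS Sz; have [n wn] := gpath_walkn gS.
by have [k _] := gpath_walkn_ends gS Sz wn; exists k.
Qed.

Lemma hyperbolic_thin_triangles :
  hyperbolic (gdist R G) -> exists K, @thin_triangles G K.
Proof.
move=> /hyperbolic_thin [D thinD].
(* Beyond [D], 1 pays for a point realizing the infimum approximately, 4 for passing from points to
   vertices, and 1 for rounding. *)
exists (Num.truncn D + 6) => a b c P S T z gP gS gT Pz.
have [P' [geoP P'P P'e]] := gpath_realization gP.
have [S' [geoS S'S S'e]] := gpath_realization gS.
have [T' [geoT T'T T'e]] := gpath_realization gT.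
have [] := thinD P' T' S' (vtx R a).
- exists (vtx R a), (vtx R b), (vtx R c); split=> //; exact: is_geodesic_sym.
- have [n wac] := gpath_walkn gS.
  move=> x [[/P'e|/T'e]|/S'e] [e [e' [t [Ce ee]]]].
  + by have [m wm] := gpath_walkn_mem gP Ce; exact: gdist_vtx_lty wm ee.
  + have [m wm] := gpath_walkn_mem gT Ce.
    exact: gdist_vtx_lty (walkn_cat wac wm) ee.
  + by have [m wm] := gpath_walkn_mem gS Ce; exact: gdist_vtx_lty wm ee.
move=> /(_ _ (P'P _ Pz)) + _ _; rewrite /neighborhood /= => zD.
have : (set_dist (gdist R G) (vtx R z) (T' `|` S') < (D + 1)%:E)%E.
  by apply: le_lt_trans zD _; rewrite lte_fin ltrDl.
move=> /ereal_inf_lt [_ [y yTS <-]] /gdist_lt [l pl lD].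
have [e [e' [t [STe ee]]]] : exists e e' t, (S `|` T) e /\ edge_coord e e' t (bary y).
  case: yTS => [/T'e|/S'e] [e [e' [t [Ce ee]]]]; exists e, e', t; split=> //.
    by right.
  by left.
have [m ml wm] := path_length_walkn (edge_coord_vtx z) ee pl.
exists e, m; split=> //.
rewrite -ltnS -(ltr_nat R) -addnS natrD; have := truncnS_gt D; rewrite -natr1; lra.
Qed.

End Realization.

(** * Minimal cycles *)

Lemma size_arc (T : eqType) (c : seq T) (u v : T) :
  uniq c -> u \in c -> v \in c ->
  size (arc c u v) = if index u c <= index v c then index v c - index u c
                     else size c + index v c - index u c.
Proof.
move=> uc uin vin.
have -> : size (arc c u v) = index v (rot (index u c) c).
  by rewrite /arc size_take index_mem mem_rot vin.
case/splitPr: uin uc vin => p1 p2 uc vin.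
have up1 : u \notin p1.
  apply/negP => up1; move: uc; rewrite cat_uniq => /and3P[_ /hasPn/(_ u)].
  by rewrite inE eqxx up1 => /(_ isT).
have iu : index u (p1 ++ u :: p2) = size p1.
  by rewrite index_cat (negbTE up1) /= eqxx addn0.
rewrite iu rot_size_cat !index_cat size_cat.
have [v1|v1] := boolP (v \in p1); have [v2|v2] := boolP (v \in u :: p2).
- by move: uc; rewrite cat_uniq => /and3P[_ /hasPn/(_ v v2)]; rewrite /= v1.
- by have := v1; rewrite -index_mem /=; case: ifPn; lia.
- by case: ifPn; lia.
- by move: vin; rewrite mem_cat (negbTE v1) (negbTE v2).
Qed.

Section CycleWalks.
Context {G : sgraph}.
Implicit Types (u v w : G) (c : seq G).

Lemma cycle_adj x0 c i : is_cycle c ->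
  adj (nth x0 c (i %% size c)) (nth x0 c (i.+1 %% size c)).
Proof.
case: c => [|u p] [/andP[cc uc] szc] //; set n := size _.
have lt_i : i %% n < n by rewrite ltn_pmod.
move: cc => /= /(pathP x0) /(_ (i %% n)); rewrite size_rcons => /(_ lt_i).
congr (adj _ _).
  case: (i %% n) lt_i => //= k lt_k.
  by rewrite nth_rcons; have -> : k < size p by [].
rewrite nth_rcons; have := divn_eq i n; set r := i %% n in lt_i * => iE.
have lt_r : r < (size p).+1 := lt_i.
case: ltngtP => [r_lt|gt_r|rE]; [|lia|].
  by rewrite iE -addnS modnMDl modn_small.
by rewrite iE rE -addnS modnMDl modnn.
Qed.

Lemma cycle_walkn c u v : is_cycle c -> u \in c -> v \in c ->
  exists2 l, l <= size c & walkn l u v.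
Proof.
move=> cc uin vin; have fadj i := @cycle_adj u c i cc.
pose n := size c; pose i := index u c; pose j := index v c.
have i_lt : i < n by rewrite index_mem.
have j_lt : j < n by rewrite index_mem.
have nthu : nth u c (i %% n) = u by rewrite modn_small// nth_index.
have nthv : nth u c ((j + n) %% n) = v by rewrite modnDr modn_small// nth_index.
have [ij|ji] := leqP i j.
  exists (j - i); first lia.
  have := @walkn_fun _ (fun i => nth u c (i %% n)) j i j (fun k _ => fadj k) ij
    (leqnn _).
  by rewrite nthu modn_small// nth_index.
exists (j + n - i); first lia.
have := @walkn_fun _ (fun i => nth u c (i %% n)) (j + n) i (j + n) (fun k _ => fadj k).
by rewrite nthu nthv; apply; lia.
Qed.

Definition cyclic_dist n i j := minn (if i <= j then j - i else n + j - i)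
                             (if j <= i then i - j else n + i - j).

Lemma cycle_distE c u v : uniq c -> u \in c -> v \in c ->
  cycle_dist c u v = cyclic_dist (size c) (index u c) (index v c).
Proof. by move=> uc uin vin; rewrite /cycle_dist !size_arc. Qed.

Lemma cycle_dist_sym c u v : cycle_dist c u v = cycle_dist c v u.
Proof. exact: minnC. Qed.

Lemma cycle_dist_triangle c u v w : uniq c -> u \in c -> v \in c -> w \in c ->
  cycle_dist c u w <= cycle_dist c u v + cycle_dist c v w.
Proof.
move=> uc uin vin win; rewrite !cycle_distE// /cyclic_dist.
move: uin vin win; rewrite -!index_mem.
move: (index u c) (index v c) (index w c) (size c) => i j k n ? ? ?.
by repeat case: ifPn; lia.
Qed.

Lemma cycle_dist_succ x0 c i : uniq c -> i < size c ->
  cycle_dist c (nth x0 c i) (nth x0 c (i.+1 %% size c)) <= 1.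
Proof.
move=> uc lt_i; have lt_j : i.+1 %% size c < size c by rewrite ltn_pmod; lia.
rewrite cycle_distE ?mem_nth// !index_uniq// /cyclic_dist.
have [lt_Si|ge_Si] := ltnP i.+1 (size c).
  by rewrite modn_small//; repeat case: ifPn; lia.
have -> : i.+1 = size c by lia.
by rewrite modnn; repeat case: ifPn; lia.
Qed.

End CycleWalks.

Section CyclePoints.
Context {R : realType} {G : sgraph}.
Implicit Types (u v w a b : G) (c p : seq G) (x : gpoint R G).

Lemma vtx_support w : bary (vtx R w) w != 0%R.
Proof. by rewrite /= on_edge_supportl// eq_sym oner_neq0. Qed.

Lemma vtx_inj u v : vtx R u = vtx R v -> u = v.
Proof.
by move=> uv; have := vtx_support u; rewrite uv => /on_edge_support [].
Qed.

Lemma segment_support a b x w : segment a b x -> bary x w != 0%R -> w = a \/ w = b.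
Proof. by move=> [t [_ _ ->]]; exact: on_edge_support. Qed.

Lemma segment_vtx a b w : segment a b (vtx R w) -> w = a \/ w = b.
Proof. by move=> /segment_support; apply; exact: vtx_support. Qed.

(** A point that is not an end has both ends in its support, so it determines its edge. *)
Lemma segment_cases a b x : segment a b x ->
  x = vtx R a \/ x = vtx R b \/ bary x a != 0%R /\ bary x b != 0%R.
Proof.
move=> [t ex]; have ex' := edge_coord_sym ex; move: (ex) (ex') => [_ _ xE] [_ _ xE'].
have [t0|t0] := eqVneq t 0%R.
  by left; apply: gpoint_eq; rewrite xE t0 on_edge0.
right; have [t1|t1] := eqVneq t 1%R.
  by left; apply: gpoint_eq; rewrite xE t1 on_edge1.
right; split; first by rewrite xE on_edge_supportl.
by rewrite xE' on_edge_supportl// -subr_eq0 addrAC subrr add0r oppr_eq0.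
Qed.

Lemma segment_left u v : u = v \/ adj u v -> segment u v (vtx R u).
Proof.
by move=> uv; exists 0%R; split=> //; [rewrite lexx ler01|rewrite /= on_edge0].
Qed.

Lemma walk_points_head u p : path adj u p -> walk_points u p (vtx R u).
Proof. by case: p => //= v p /andP[uv _]; left; apply: segment_left; right. Qed.

Lemma walk_points_cat u p q : path adj (last u p) q ->
  walk_points u (p ++ q) = walk_points u p `|` walk_points (last u p) q
    :> set (gpoint R G).
Proof.
elim: p u => [|v p IHp] u /= pq; last by rewrite IHp// setUA.
by rewrite setUidr// => _ ->; exact: walk_points_head.
Qed.

Lemma walk_points_vtx u p w : path adj u p ->
  walk_points u p (vtx R w) <-> w \in u :: p.
Proof.
elim: p u => [|v p IHp] u /=.
  by move=> _; rewrite inE; split=> [/vtx_inj ->|/eqP ->].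
move=> /andP[uv pp]; rewrite inE; split=> [[/segment_vtx[]->|/(IHp _ pp) ->]|].
- by rewrite eqxx.
- by rewrite mem_head orbT.
- by rewrite orbT.
- case/orP => [/eqP ->|/(IHp _ pp)]; last by right.
  by left; apply: segment_left; right.
Qed.

Lemma walk_points_mem u p w : walk_points u p (vtx R w) -> w \in u :: p.
Proof.
elim: p u => [|v p IHp] u /=; first by move=> /vtx_inj ->; rewrite inE.
case=> [/segment_vtx[]->|/IHp]; rewrite !inE ?eqxx ?orbT//.
by move=> ->; rewrite orbT.
Qed.

Lemma walk_points_segment (x0 : G) u p x : walk_points u p x ->
  x = vtx R (last u p) \/
  exists2 i, i < size p & segment (nth x0 (u :: p) i) (nth x0 p i) x.
Proof.
elim: p u => [|v p IHp] u /=; first by left.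
case=> [uv|/IHp [->|[i lt_i sx]]]; [|by left|]; right.
  by exists 0.
by exists i.+1.
Qed.

Lemma cycle_points_vtx c w : is_cycle c ->
  cycle_points R c (vtx R w) <-> w \in c.
Proof.
case: c => [|u p] [/andP[cc _] _] //=; rewrite walk_points_vtx//.
by rewrite -rcons_cons mem_rcons inE orb_idl// => /eqP ->; exact: mem_head.
Qed.

Lemma cycle_points_segment (x0 : G) c x : is_cycle c -> cycle_points R c x ->
  exists2 i, i < size c &
    segment (nth x0 c i) (nth x0 c (i.+1 %% size c)) x.
Proof.
case: c => [|u p] // cc; have cadj i := @cycle_adj _ x0 _ i cc.
move=> /(walk_points_segment x0) [->|[i]]; rewrite ?last_rcons ?size_rcons.
  exists 0 => //; have := cadj 0; rewrite mod0n => ac.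
  by apply: segment_left; right.
move=> lt_i; rewrite -rcons_cons !nth_rcons lt_i => sx; exists i => //; move: sx.
rewrite /=; have [lt_Si|gt_i|iE] := ltngtP i (size p).
- by rewrite modn_small.
- by move: lt_i; rewrite /=; lia.
- by rewrite iE modnn.
Qed.

(** The shortcut is shorter than the arc that it replaces, and its end [u] lies on both cycles. *)
Lemma reduction_size c c' : reduction R c c' ->
  size c' < size c /\ exists2 u, u \in c & u \in c'.
Proof.
move=> [oc oc' [u [v [p [eta [[wp pc szp] seta c'E]]]]]].
have [[cc _] [cc' _]] := (oc, oc').
have uc : uniq c by case: cc => /andP[].
have [uin vin] : u \in c /\ v \in c.
  split; apply/(cycle_points_vtx _ cc).
    by have [] : (walk_points u p `&` cycle_points R c) (vtx R u) by rewrite pc; left.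
  by have [] : (walk_points u p `&` cycle_points R c) (vtx R v) by rewrite pc; right.
have neq_uv : u != v.
  apply/eqP => uv; move: szp; rewrite uv /cycle_dist size_arc// leqnn subnn.
  by rewrite minnn.
split; last first.
  exists u => //; apply/(cycle_points_vtx _ cc'); rewrite c'E; right.
  by case: wp => /walk_points_head.
have [i p1 p2 a1 a2 rotE] := rot_to_arc uc uin vin neq_uv.
have szc : size c = size (u :: p1) + size (v :: p2).
  by rewrite -(size_rot i) rotE -cat_cons size_cat.
move: seta szp; rewrite /subarc /= -a1 -a2 /cycle_dist /= leq_min -a1 -a2 => seta.
move=> /andP[szp1 szp2]; case: wp => pp lp.
have vp : v \in p.
  by move: (mem_last u p); rewrite lp inE eq_sym (negbTE neq_uv).
(* The list [s] collects the vertices of the kept arc and of the shortcut. As [c'] has no repeated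
   vertex, [s] bounds its length. *)
have [s szs sub] : exists2 s : seq G, size s < size c &
    forall w, walk_points u p (vtx R w) \/ eta (vtx R w) -> w \in s.
  rewrite /= in szp1 szp2.
  case: seta => ->; [exists (u :: p1 ++ p)|exists (u :: p2 ++ p)];
    rewrite /= ?size_cat ?szc /=; try lia; move=> w; rewrite !inE mem_cat;
    case=> /walk_points_mem; rewrite !(inE, mem_rcons).
  - by case/orP => ->; rewrite ?orbT.
  - by case/or3P=> [->|/eqP ->|->]; rewrite ?vp ?orbT.
  - by case/orP => ->; rewrite ?orbT.
  - by case/or3P=> [/eqP ->|->|->]; rewrite ?vp ?orbT.
apply: leq_ltn_trans szs; apply: uniq_leq_size; first by case: cc' => /andP[].
by move=> w /(cycle_points_vtx _ cc'); rewrite c'E => -[?|?]; apply: sub; [right|left].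
Qed.

(** Reductions are iterated until none exists. Each one is reached by walking along the current
    cycle to a shared vertex, at a cost of at most [size c], and lengths strictly decrease, so at
    most [size c] reductions occur. *)
Lemma odd_cycle_near_minimal c w : odd_cycle c -> w \in c ->
  exists c' w' l, [/\ minimal_cycle R c', w' \in c', l <= size c * size c
                   & walkn l w w'].
Proof.
have [n] := ubnP (size c); elim: n c w => // n IHn c w szc oc win.
have [[c' red]|irr] := pselect (exists c', reduction R c c'); last first.
  by exists c, w, 0; split=> //; exact: walkn_refl.
have [szc' [u uin uin']] := reduction_size red.
have [_ oc' _] := red; have [cc _] := oc.
have [|c2 [w2 [l [mc2 w2in szl wl]]]] := IHn c' u _ oc' uin'; first lia.
have [k szk wk] := cycle_walkn cc win uin.
exists c2, w2, (k + l); split=> //; last exact: walkn_cat wk wl.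
by have : size c' * size c' <= size c' * size c; nia.
Qed.

(** The term [k] pays for reaching an odd cycle of length at most [k], and [k * k] for the
    reductions from there to a minimal cycle. *)
Lemma odd_loop_near_minimal k u : odd_loop k u ->
  (dist_minimal (vtx R u) <= (k + k * k)%:R%:E)%E.
Proof.
move=> [l [lk ol [p wp szp]]]; rewrite -szp in ol lk.
have [c [w [m [oc szc win mp wm]]]] := odd_closed_walk_odd_cycle wp ol.
have [c' [w' [m' [mc' w'in m'sz wm']]]] := odd_cycle_near_minimal oc win.
apply: (@le_trans _ _ (gdist R G (vtx R u) (vtx R w'))).
  apply: (@le_trans _ _ (set_dist (gdist R G) (vtx R u) (cycle_points R c'))).
    by apply: ereal_inf_lbound; exists c'.
  apply: ereal_inf_lbound; exists (vtx R w') => //.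
  by apply/cycle_points_vtx => //; case: mc' => -[].
apply: le_trans (gdist_vtx (walkn_cat wm wm')) _.
by rewrite lee_fin ler_nat; nia.
Qed.

(** The reduction follows [c] from [v] to [u] and returns along [p]. Since [shortcut] speaks of
    point sets, interior points of edges must also be shown not to be shared. *)
Lemma shortcut_reduction c u v p : odd_cycle c -> u \in c -> v \in c ->
  u != v -> is_walk u v (rcons p v) -> uniq p -> {in p, forall w, w \notin c} ->
  (size p).+1 < cycle_dist c u v -> odd (size (arc c v u) + (size p).+1) ->
  exists c', reduction R c c'.
Proof.
move=> oc uin vin neq_uv wp up avoid szp oddp; have [cc _] := oc.
have [/andP[cyc_c uc] _] := cc; have [pp _] := wp.
rewrite eq_sym in neq_uv.
have [i p1 p2 a1 a2 rotE] := rot_to_arc uc vin uin neq_uv.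
have sub w : w \in v :: p1 -> w \in c.
  by move=> win; rewrite -(mem_rot i) rotE -cat_cons mem_cat win.
have pathc : path adj v (p1 ++ [:: u]).
  move: cyc_c; rewrite -(rot_cycle i) rotE /= rcons_path cat_path /=.
  by case/andP=> /andP[pp1 /andP[au _]] _; rewrite cat_path pp1 /= au.
have oc' : odd_cycle (v :: p1 ++ u :: p).
  split; last by move: oddp; rewrite -a1 /= size_cat /= addnS -addSn.
  split; last first.
    move: szp; rewrite /cycle_dist leq_min -a1 -a2 /= size_cat /=; lia.
  apply/andP; split.
    rewrite /= rcons_cat /= -cat1s catA cat_path pathc last_cat /=.
    exact: pp.
  move: uc; rewrite -(rot_uniq i) rotE -!cat_cons !cat_uniq => /and3P[-> /hasPn d _].
  have ud : u \notin v :: p1 by apply: d; rewrite mem_head.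
  rewrite /= up andbT; apply/andP; split; last first.
    by apply/negP => /avoid; rewrite uin.
  rewrite negb_or ud; apply/hasPn => w /avoid; apply: contra; exact: sub.
exists (v :: p1 ++ u :: p); split=> //.
exists u, v, (rcons p v), (walk_points v (rcons p1 u)); split.
- split; rewrite ?size_rcons//.
  have vtxP w : w \in c -> w \in u :: rcons p v -> [set vtx R u; vtx R v] (vtx R w).
    move=> win; rewrite inE mem_rcons inE => /or3P[/eqP ->|/eqP ->|/avoid].
    - by left.
    - by right.
    - by rewrite win.
  apply/seteqP; split=> x; last first.
    case=> ->; split; try exact/(cycle_points_vtx _ cc).
      by apply/(walk_points_vtx _ pp); rewrite mem_head.
    by apply/(walk_points_vtx _ pp); rewrite inE mem_rcons mem_head orbT.
  move=> [/(walk_points_segment u) [->|[k]]]; first by rewrite last_rcons; right.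
  set a := nth _ _ _; set b := nth _ _ _ => lt_k sx xc.
  have ain : a \in u :: rcons p v by apply: mem_nth; rewrite /= ltnS ltnW.
  have bin : b \in u :: rcons p v by rewrite inE mem_nth ?orbT.
  have [xa|[xb|[xa xb]]] := segment_cases sx.
  + by rewrite xa in xc *; apply: vtxP => //; exact/(cycle_points_vtx _ cc).
  + by rewrite xb in xc *; apply: vtxP => //; exact/(cycle_points_vtx _ cc).
  (* A common interior point would make the edge of the shortcut an edge of [c]. Both its ends would
     lie on [c], hence be [u] and [v], which would then be at distance at most 1 on [c]. *)
  have [j lt_j sxj] := cycle_points_segment u cc xc.
  have adjab : adj a b by move/pathP: pp => /(_ u _ lt_k).
  have d1 := cycle_dist_succ u uc lt_j.
  have c1 : nth u c j \in c by apply: mem_nth.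
  have c2 : nth u c (j.+1 %% size c) \in c.
    by apply: mem_nth; rewrite ltn_pmod//; exact: leq_ltn_trans lt_j.
  have [ea eb] := (segment_support sxj xa, segment_support sxj xb).
  have ac : a \in c by case: ea => ->.
  have bc : b \in c by case: eb => ->.
  have := vtxP _ ac ain; have := vtxP _ bc bin.
  suff : cycle_dist c a b <= 1.
    move=> dab; case=> /vtx_inj bE [] /vtx_inj aE.
    - by rewrite aE bE adj_irr in adjab.
    - by move: dab; rewrite aE bE cycle_dist_sym leqNgt (leq_trans _ szp).
    - by move: dab; rewrite aE bE leqNgt (leq_trans _ szp).
    - by rewrite aE bE adj_irr in adjab.
  case: ea eb adjab => -> [] -> //; rewrite ?adj_irr// => _.
  by rewrite cycle_dist_sym.
- by right; rewrite -a1.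
- rewrite /= rcons_cat /= -cat_rcons walk_points_cat ?last_rcons//.
Qed.

(** Consider a shortest walk violating the bound, made simple. If it met [c] in between, its two
    pieces would obey the bound by induction, and so would the whole by the triangle inequality on
    [c]. Hence it is a shortcut, and as [c] is odd it yields a reduction. *)
Lemma minimal_cycle_isometric c u v l : minimal_cycle R c ->
  u \in c -> v \in c -> walkn l u v -> cycle_dist c u v <= l.
Proof.
move=> [oc irr]; have [cc odd_c] := oc; have uc : uniq c by case: cc => /andP[].
elim/ltn_ind: l u v => l IHl u v uin vin [q [qp lq] szq].
rewrite leqNgt; apply/negP => lt_l.
have neq_uv : u != v.
  apply/eqP => uv; move: lt_l; rewrite uv /cycle_dist size_arc// leqnn subnn.
  by rewrite minnn.
case/shortenP: qp lq => q' qp' uq' sub lq'; have szq' : size q' <= l.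
  rewrite -szq; apply: uniq_leq_size => //; by case/andP: uq'.
case/lastP: q' => [|p x] in qp' uq' sub lq' szq'; first by move/eqP: neq_uv.
rewrite last_rcons in lq'; rewrite {x}lq' size_rcons in qp' uq' sub szq'.
move: uq'; rewrite /= rcons_uniq => /and3P[_ _ up].
have wp : is_walk u v (rcons p v) by split; rewrite ?last_rcons.
have avoid : {in p, forall w, w \notin c}.
  move=> w wp'; apply/negP => win; case/splitPr: wp' qp' szq' => p1 p2.
  rewrite -cat_rcons rcons_cat cat_path last_rcons size_cat size_rcons.
  move=> /andP[pp1 pp2] sz12.
  have w1 : walkn (size p1).+1 u w.
    by exists (rcons p1 w); rewrite ?size_rcons//; split; rewrite ?last_rcons.
  have w2 : walkn (size p2).+1 w v.
    by exists (rcons p2 v); rewrite ?size_rcons//; split; rewrite ?last_rcons.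
  have lt1 : (size p1).+1 < l by move: sz12; clear; lia.
  have lt2 : (size p2).+1 < l by move: sz12; clear; lia.
  have d1 := IHl _ lt1 _ _ uin win w1; have d2 := IHl _ lt2 _ _ win vin w2.
  by have := cycle_dist_triangle uc uin win vin; lia.
have [i p1 p2 a1 a2 rotE] := rot_to_arc uc uin vin neq_uv.
have szc : size c = size (arc c u v) + size (arc c v u).
  by rewrite -(size_rot i) rotE -cat_cons a1 a2 size_cat.
(* The shortcut closes exactly one of the two arcs of [c] to an odd cycle. *)
case: (boolP (odd (size (arc c v u) + (size p).+1))) => op.
  apply: irr; apply: shortcut_reduction wp up avoid _ op => //.
  exact: leq_ltn_trans szq' lt_l.
apply: irr; apply: (@shortcut_reduction c v u (rev p)) => //.
- by rewrite eq_sym.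
- by have := is_walk_rev wp; rewrite belast_rcons rev_cons.
- by rewrite rev_uniq.
- by move=> w; rewrite mem_rev; exact: avoid.
- by rewrite size_rev cycle_dist_sym; exact: leq_ltn_trans szq' lt_l.
- rewrite size_rev; move: odd_c op; rewrite szc !oddD.
  by case: (odd (size (arc c u v))); case: (odd (size (arc c v u))); case: (odd _).
Qed.

End CyclePoints.

(** * Lifts to the product *)

(** This unrolls the cycle onto the line: [b] is within [l] of some translate of [a] by a multiple
    of [n]. The number of turns [e] is the difference of the quotients, corrected by at most one. *)
Lemma cyclic_dist_congruence n l a b :
  0 < n -> a <= b -> cyclic_dist n (a %% n) (b %% n) <= l ->
  exists e, b <= a + e * n + l /\ a + e * n <= b + l.
Proof.
move=> n0 ab; have q_le := leq_div2r n ab; have [aE bE] := (divn_eq a n, divn_eq b n).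
have [a_lt b_lt] := (ltn_pmod a n0, ltn_pmod b n0).
move: aE bE a_lt b_lt; rewrite -(subnKC q_le) mulnDl; set q := _ - _.
move: (a %% n) (b %% n) (a %/ n * n) => a' b' qa aE bE a_lt b_lt {q_le}.
rewrite /cyclic_dist geq_min.
case: (ltngtP a' b') => [lt_ab|lt_ba|eq_ab].
- by case/orP=> le_l; [exists q|exists q.+1; rewrite mulSn]; lia.
- case/orP=> le_l; last by exists q; lia.
  case: q bE => [|q] bE; first lia.
  by exists q; rewrite mulSn in bE; lia.
- by move=> _; exists q; lia.
Qed.

Section DoubleCover.
Context {G1 G2 : sgraph}.
Local Notation H := (direct_product G1 G2).
Variable v : bool -> G2.
Hypothesis v_adj : forall b, adj (v b) (v (~~ b)).
Hypothesis G2_even : forall (x : G2) l, walkn l x x -> ~~ odd l.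

Definition lift (w : G1) (b : bool) : H := (w, v b).

Lemma walkn_fst l (x y : H) : walkn l x y -> walkn l x.1 y.1.
Proof.
move=> [p [pp <-] <-]; exists (map fst p); last by rewrite size_map.
split; last by rewrite last_map.
elim: p x pp => //= y' p IHp x /andP[/andP[xy _] /IHp ->]; by rewrite xy.
Qed.

Lemma walkn_snd l (x y : H) : walkn l x y -> walkn l x.2 y.2.
Proof.
move=> [p [pp <-] <-]; exists (map snd p); last by rewrite size_map.
split; last by rewrite last_map.
elim: p x pp => //= y' p IHp x /andP[/andP[_ xy] /IHp ->]; by rewrite xy.
Qed.

(** The projection to [G2] joins [v b] to [v b']. It is closed, or becomes closed after adding one
    edge, and closed walks of [G2] are even. *)
Lemma walkn_lift_parity l w w' b b' : walkn l (lift w b) (lift w' b') ->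
  odd l = b (+) b'.
Proof.
move=> /walkn_snd /= wl; have [bb|bb] := eqVneq b b'.
  by rewrite -bb addbb in wl *; exact/negbTE/(G2_even wl).
have w1 : walkn 1 (v b') (v b).
  by have := walkn_adj (v_adj b'); have -> : ~~ b' = b by case: b b' bb {wl} => -[].
have := G2_even (walkn_cat wl w1); rewrite addn1 /= negbK => ->.
by case: b b' bb {wl w1} => -[].
Qed.

Lemma walkn_lift l w w' b : walkn l w w' -> walkn l (lift w b) (lift w' (b (+) odd l)).
Proof.
move=> [p [pp <-] <-]; elim: p w b pp => [|x p IHp] w b /=.
  by rewrite addbF => _; exact: walkn_refl.
move=> /andP[wx pp]; rewrite -add1n.
have -> : b (+) ~~ odd (size p) = ~~ b (+) odd (size p) by rewrite addbN addNb.
apply: walkn_cat (IHp _ _ pp).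
by apply: walkn_adj; rewrite /= /dprod_adj /= wx v_adj.
Qed.

(** Projecting to [G1] preserves the length of walks, so a lift is geodesic as soon as its
    projection is. Only the stretch from [j] to [j + n] is constrained, which allows [f] to wind
    around a cycle. *)
Lemma gpath_lift (f : nat -> G1) j n b :
  (forall i, j <= i < j + n -> adj (f i) (f i.+1)) ->
  (forall i i' l, j <= i -> i <= i' -> i' <= j + n -> walkn l (f i) (f i') ->
     i' - i <= l) ->
  gpath (lift (f j) (b (+) odd j)) (lift (f (j + n)) (b (+) odd (j + n)))
    [set z | exists2 i, j <= i <= j + n & lift (f i) (b (+) odd i) = z].
Proof.
move=> fadj fgeo; exists (fun i => lift (f (j + i)) (b (+) odd (j + i))), n.
split; rewrite ?addn0//.
- move=> i lt_in; rewrite /= /dprod_adj /= addnS fadj; last lia.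
  by rewrite /= addbN v_adj.
- move=> i i' l ii' i'n /walkn_fst /= /fgeo; rewrite subnDl; apply; lia.
- apply/seteqP; split=> _ [i lei <-].
    by case/andP: lei => ji ijn; exists (i - j); rewrite ?leq_subLR// subnKC.
  by exists (j + i) => //; lia.
Qed.

Variable K : nat.
Hypothesis thinK : @thin_triangles H K.

(** The quadrilateral consists of the two lifts of the geodesic and of two sides, of length at most
    [k], joining the lifts of each end. If [f i] is near a short side, it is within [k + 2 K] of an
    end and borrows the odd loop there, going out and back. *)
Lemma odd_loop_geodesic (f : nat -> G1) n k i :
  (forall i, i < n -> adj (f i) (f i.+1)) ->
  (forall i j l, i <= j -> j <= n -> walkn l (f i) (f j) -> j - i <= l) ->
  odd_loop k (f 0) -> odd_loop k (f n) -> i <= n ->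
  odd_loop (k + (k + (K + K)).*2) (f i).
Proof.
move=> fadj fgeo o0 on lein.
have gP b := @gpath_lift f 0 n b (fun i => fadj i)
  (fun i j l _ ij jn => fgeo i j l ij jn).
have loop w b : odd_loop k w ->
    exists l, l <= k /\ walkn l (lift w b) (lift w (~~ b)).
  by move=> [l [lk ol /(walkn_lift b)]]; rewrite ol addbT; exists l.
have close w z l m : odd_loop k w -> l <= k -> walkn l w z -> m <= K + K ->
    walkn m (f i) z -> odd_loop (k + (k + (K + K)).*2) (f i).
  move=> ow lk wl mK wm.
  have [r [rk or wr]] := odd_loop_walkn ow (walkn_cat wl (walkn_sym wm)).
  by exists r; split=> //; clear -rk lk mK; lia.
have [[l0 [l0k w0]] [ln [lnk wn]]] := (loop _ false o0, loop _ (odd n) on).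
have [[S gS] [U gU]] := (gpath_exists w0, gpath_exists wn).
have [|z [m [[Sz|[[j jn <-]|Uz]] mK wm]]] := thin_quadrilateral thinK
    (gP false) gS (gP true) (gpath_sym gU) (z := lift (f i) (odd i)); first by exists i.
- have [r rl wr] := gpath_walkn_ends gS Sz w0.
  exact: close o0 (leq_trans rl l0k) (walkn_fst wr) mK (walkn_fst wm).
(* Near the opposite lift, at [f j], the parity of [m] differs from that of [i + j]. Returning along
   the geodesic takes a number of steps of the same parity as [i + j] and at most [m], so the loop
   closes with odd length. *)
- have om := walkn_lift_parity wm; have {}wm := walkn_fst wm; rewrite /= in om wm.
  have [r [rm ro wr]] :
      exists r, [/\ r <= m, odd r = odd i (+) odd j & walkn r (f j) (f i)].
    case: (leqP i j) => [le_ij|/ltnW le_ji].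
      exists (j - i); rewrite (fgeo _ _ _ le_ij _ wm)//; split=> //.
        by rewrite oddB// addbC.
      exact/walkn_sym/(walkn_fun fadj).
    exists (i - j); rewrite (fgeo _ _ _ le_ji lein (walkn_sym wm)); split=> //.
      by rewrite oddB.
    exact: (walkn_fun fadj).
  exists (m + r); split; last exact: walkn_cat wm wr.
    by clear -mK rm; lia.
  by rewrite oddD om ro; case: (odd i); case: (odd j).
- have [r rl wr] := gpath_walkn_ends gU Uz wn.
  exact: close on (leq_trans rl lnk) (walkn_fst wr) mK (walkn_fst wm).
Qed.

(** With [n = 2 k + 1], the cycle itself is short enough if [k <= 6 K + 3]. Otherwise the thin
    pentagon gives an odd loop of length at most [6 K]. *)
Lemma minimal_cycle_odd_loop (R : realType) (c : seq G1) u :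
  minimal_cycle R c -> u \in c -> odd_loop (12 * K + 7) u.
Proof.
move=> mc uin; have [[cc odd_c] _] := mc; have uc : uniq c by case: cc => /andP[].
pose n := size c; pose k := n./2; pose m := k./2.
have nE : n = k.*2.+1 by rewrite -[LHS]odd_double_half odd_c.
have mE : m.*2 <= k <= m.*2.+1.
  by rewrite -[k]odd_double_half; case: odd; clear; lia.
have n0 : 0 < n by rewrite nE.
(* The periodic parametrization [f] is shifted to put [u] at time [m], the middle of the side from 0
   to [k]; adding [n] avoids truncated subtraction. *)
pose s := index u c + n - m; pose f j := nth u c ((s + j) %% n).
have fadj j : adj (f j) (f j.+1) by rewrite /f addnS; exact: cycle_adj.
have fin j : f j \in c by rewrite mem_nth// ltn_pmod.
have mn : m <= n by clear -nE mE; lia.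
have fm : f m = u.
  rewrite /f /s subnK; last by clear -mn; lia.
  by rewrite modnDr modn_small ?nth_index// index_mem.
have fn j : f (j + n) = f j by rewrite /f addnA modnDr.
have iso i j l : i <= j -> walkn l (f i) (f j) ->
    exists e, j <= i + e * n + l /\ i + e * n <= j + l.
  move=> ij /(minimal_cycle_isometric mc (fin i) (fin j)).
  rewrite cycle_distE// !index_uniq// ?ltn_pmod// => cl.
  have sij : s + i <= s + j by rewrite leq_add2l.
  by have [e [e1 e2]] := cyclic_dist_congruence n0 sij cl; exists e; clear -e1 e2; lia.
have loop_n : walkn n u u.
  have := walkn_fun (fun j _ => fadj j) (leq_addr n m) (leqnn _).
  by rewrite addKn fn fm.
have [k_small|k_large] := leqP k (6 * K + 3).
  by exists n; split=> //; clear -nE k_small; lia.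
pose fl j := lift (f j) (odd j).
pose side j l : set H := [set z | exists2 i, j <= i <= j + l & fl i = z].
(* A walk that amounts to going around the other way has length at least [n - k = k + 1], so it is
   no shorter. *)
have gside j l : l <= k -> gpath (fl j) (fl (j + l)) (side j l).
  move=> lk; apply: (@gpath_lift f j l false) => // i i' r ji ii' i'l wr.
  have [[|e]] := iso _ _ _ ii' wr; rewrite ?mul0n ?mulSn;
    clear -ji ii' i'l lk nE; lia.
(* As 2 n = 4 k + 2, the pentagon has four sides of length k and one of length 2. *)
have f2n : fl (4 * k + 2) = fl 0.
  have -> : 4 * k + 2 = 0 + n + n by rewrite nE; clear; lia.
  by rewrite /fl !fn !oddD nE /= odd_double.
have g5 : gpath (fl (4 * k)) (fl 0) (side (4 * k) 2).
  by rewrite -f2n; apply: gside; clear -k_large; lia.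
have gk i : gpath (fl (i.+1 * k)) (fl (i * k)) (side (i * k) k).
  by rewrite mulSnr; exact: gpath_sym (gside (i * k) k (leqnn k)).
have g1 := gside 0 k (leqnn k); rewrite add0n -{1}[k]mul1n in g1.
have Sm : side 0 k (fl m) by exists m => //; clear -mE; lia.
have [z [l [Sz lK wl]]] :=
  thin_pentagon thinK g1 (gpath_sym g5) (gk 3) (gk 2) (gk 1) Sm.
have {Sz} [j kj zE] : exists2 j, k <= j <= n + n & fl j = z.
  case: Sz => [[j jb <-]|[[j jb <-]|[[j jb <-]|[j jb <-]]]]; exists j => //;
    clear -jb nE k_large; lia.
rewrite -{}zE in wl; have ol := walkn_lift_parity wl; have {}wl := walkn_fst wl.
have mj : m <= j by clear -mE kj; lia.
have [e [je ej]] := iso _ _ _ mj wl.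
(* The time [j] is within [3 K] of [m + e * n]. Since [k <= j <= 2 n] and both [m] and [k - m]
   exceed [3 K], neither [e = 0] nor [e >= 2] is possible. *)
have e1 : e = 1.
  case: e je ej => [|[|e]] //; rewrite ?mul0n ?mulSn => je ej; exfalso;
    clear -je ej kj k_large mE lK; lia.
rewrite {}e1 mul1n in je ej.
(* Going along the cycle from [j] to [m + n] returns to [u]. As [n] is odd, this stretch and the
   walk of length [l] have opposite parities. *)
have [r [rl ro wr]] :
    exists r, [/\ r <= l, odd r = ~~ (odd m (+) odd j) & walkn r (f j) (f m)].
  rewrite -(fn m); case: (leqP (m + n) j) => [le_mj|/ltnW le_jm].
    exists (j - (m + n)); split; first by clear -je; lia.
      by rewrite oddB// oddD nE /= odd_double; case: (odd m); case: (odd j).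
    exact/walkn_sym/(walkn_fun (fun i _ => fadj i)).
  exists (m + n - j); split; first by clear -ej; lia.
    by rewrite oddB// oddD nE /= odd_double; case: (odd m); case: (odd j).
  exact: (walkn_fun (fun i _ => fadj i)).
exists (l + r); rewrite -fm; split; last exact: walkn_cat wl wr.
  by clear -lK rl; lia.
by rewrite oddD ol ro; case: (odd m); case: (odd j).
Qed.

End DoubleCover.

(** * Metric geodesics through a vertex *)

Section GeodesicThroughVertex.
Local Open Scope ring_scope.
Context {R : realType} {G : sgraph}.
Implicit Types (x y : gpoint R G) (u : G).

Lemma edge_coord_vtx_inv u a b (t : R) : edge_coord a b t (bary (vtx R u)) ->
  u = a \/ [/\ u = b, u != a & t = 1].
Proof.
move=> ex; have [->|neq_ua] := eqVneq u a; first by left.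
have seg : segment a b (vtx R u) by exists t.
right; have [/eqP|ub] := segment_vtx seg; first by rewrite (negbTE neq_ua).
split=> //; case: ex => _ _ /= /(congr1 (fun h => h a)).
rewrite /on_edge eqxx -ub eq_sym (negbTE neq_ua) !mulr0n mulr1n !addr0 => /eqP.
by rewrite eq_sym subr_eq0 => /eqP.
Qed.

(** A path staying inside one edge is also brought to the form of an offset followed by a walk, by
    choosing the end of the edge to leave through. *)
Lemma path_length_to_vtx x u (l : R) : path_length x (vtx R u) l ->
  exists a a' s m, [/\ edge_coord a a' s (bary x), walkn m a u & s + m%:R <= l].
Proof.
case=> [[a [b [s [t [ex ey ->]]]]]|[a [a' [b [b' [s [t [p [ex ey [pp lp] ->]]]]]]]]].
  have [ua|[ub _ t1]] := edge_coord_vtx_inv ey; last first.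
    exists b, a, (1 - s), 0%N; rewrite ub t1; split.
    - exact: edge_coord_sym.
    - exact: walkn_refl.
    - by rewrite addr0 distrC ler_norm.
  have [ub|[_ _ t0]] := edge_coord_vtx_inv (edge_coord_sym ey).
    exists a, a, 0, 0%N; rewrite ua; split; last by rewrite addr0 normr_ge0.
    - case: ex => _ _ xE; split; [by left|by rewrite lexx ler01|].
      by rewrite xE -ub ua on_edge_refl.
    - exact: walkn_refl.
  exists a, b, s, 0%N; rewrite ua; split=> //; first exact: walkn_refl.
  have -> : t = 0 by lra.
  by rewrite addr0 subr0 ler_norm.
have wp : walkn (size p) a b by exists p.
have [_ /andP[t0 _] _] := ey.
have [->|[-> neq_ub t1]] := edge_coord_vtx_inv ey.
  by exists a, a', s, (size p); split=> //; lra.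
exists a, a', s, (size p + 1)%N; split=> //; last by rewrite natrD t1; lra.
apply: walkn_cat wp _; apply: walkn_adj; case: ey => -[bb'|//] _ _.
by rewrite bb' eqxx in neq_ub.
Qed.

(** The distances from [u] to [x] and [y] add up to the length of [g]. Approximating each within 1/4
    gives [m + n < l + 1/2] for any walk of length [l] from [a] to [b], and integrality does the
    rest; no infimum has to be attained. *)
Lemma geodesic_through_vertex x y u g : is_geodesic (gdist R G) x y g -> g (vtx R u) ->
  exists a a' s b b' t m n,
    [/\ edge_coord a a' s (bary x), edge_coord b b' t (bary y),
        walkn m a u, walkn n u b & forall l, walkn l a b -> (m + n <= l)%N].
Proof.
move=> [L [gam [L0 <- <- giso ->]]] [r /= rb ru].
have near_r s : 0 <= s <= L -> exists a a' q m,
    [/\ edge_coord a a' q (bary (gam s)), walkn m a u & q + m%:R < `|s - r| + 4^-1].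
  move=> sb; have : (gdist R G (gam s) (vtx R u) < (`|s - r| + 4^-1)%:E)%E.
    by rewrite -ru giso// lte_fin; lra.
  move=> /gdist_lt [l /path_length_to_vtx [a [a' [q [m [ex wm le_l]]]]] lt_l].
  by exists a, a', q, m; split=> //; lra.
have [|a [a' [s [m [ex wm ltm]]]]] := near_r 0; first lra.
have [|b [b' [t [n [ey wn ltn]]]]] := near_r L; first lra.
exists a, a', s, b, b', t, m, n; split=> //; first exact: walkn_sym.
move=> l [p wp szp]; have : (gdist R G (gam 0%R) (gam L) <= (s + l%:R + t)%R%:E)%E.
  by apply: gdist_le; right; exists a, a', b, b', s, t, p; rewrite szp.
rewrite giso; [|lra|lra]; rewrite lee_fin !sub0r normrN ger0_norm//.
move: ltm ltn; rewrite sub0r normrN ger0_norm; last lra.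
rewrite ger0_norm; last lra.
move=> ltm ltn le_L; rewrite -ltnS -(ltr_nat R) -natr1 natrD; lra.
Qed.

Lemma cycle_points_near c x a a' (s : R) : is_cycle c -> cycle_points R c x ->
  edge_coord a a' s (bary x) -> exists w l, [/\ w \in c, (l <= 1)%N & walkn l w a].
Proof.
move=> cc xc ex; have [i lt_i sx] := cycle_points_segment a cc xc.
have [w _ xw] := edge_coord_support ex.
have [l l1 wl] := edge_coord_near ex xw.
exists w, l; split=> //; last exact: walkn_sym.
have [->|->] := segment_support sx xw; first exact: mem_nth.
by apply: mem_nth; rewrite ltn_pmod//; exact: leq_ltn_trans lt_i.
Qed.

End GeodesicThroughVertex.

(** * Non-hyperbolicity of the product *)

Lemma nontrivial_graph_edge (G : sgraph) : connected_graph G -> ~ trivial_graph G ->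
  exists a b : G, adj a b.
Proof.
move=> [[a] conn] nontriv; apply: contrapT => noedge; apply: nontriv.
exists a => b; have [[|x p] [/= pp lp]] := conn a b; first by rewrite lp.
by case: noedge; exists a, x; case/andP: pp.
Qed.

Theorem theorem2p26 (R : realType) (G1 G2 : sgraph)
  (G1_connected : connected_graph G1)
  (G2_connected : connected_graph G2)
  (G1_odd : exists c : seq G1, odd_cycle c)
  (G2_nontrivial : ~ trivial_graph G2)
  (G2_bounded : bounded_graph R G2)
  (G2_no_odd : ~ exists c : seq G2, odd_cycle c)
  (G1_far : forall M : R, (0 < M)%R ->
     exists (C1 C2 : seq G1) (x y : gpoint R G1) (g : set (gpoint R G1)) (u : G1),
       minimal_cycle R C1 /\ minimal_cycle R C2 /\
       cycle_points R C1 x /\ cycle_points R C2 y /\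
       is_geodesic (gdist R G1) x y g /\
       g (vtx R u) /\ (M%:E <= dist_minimal (vtx R u))%E) :
  ~ hyperbolic (gdist R (direct_product G1 G2)).
Proof.
move=> /hyperbolic_thin_triangles [K thinK].
have [v0 [v1 v01]] := nontrivial_graph_edge G2_connected G2_nontrivial.
pose v b := if b then v1 else v0.
have v_adj b : adj (v b) (v (~~ b)) by case: b => //=; rewrite adj_sym.
have G2_even (x : G2) l : walkn l x x -> ~~ odd l.
  move=> [p wp <-]; apply/negP => op; apply: G2_no_odd.
  by have [c [_ [_ [oc _ _ _ _]]]] := odd_closed_walk_odd_cycle wp op; exists c.
(* The extra 2 pays for going from an end of the edge of [x] or [y] to an adjacent vertex of the
   minimal cycle and back. The bound [k'] is the one propagated along a geodesic, and the chosen
   distance exceeds [k' + k' * k']. *)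
pose k := 12 * K + 7 + 2; pose k' := k + (k + (K + K)).*2.
have M0 : (0 < (k' + k' * k' + 1)%:R :> R)%R by rewrite ltr0n addn1.
have [C1 [C2 [x [y [g [u [mC1 [mC2 [xC1 [yC2 [geo [gu far]]]]]]]]]]]] := G1_far _ M0.
have [a [a' [s [b [b' [t [m [n [ex ey wm wn minmn]]]]]]]]] :=
  geodesic_through_vertex geo gu.
have loop (c : seq G1) z e e' r : minimal_cycle R c -> cycle_points R c z ->
    edge_coord e e' r (bary z) -> odd_loop k e.
  move=> mc zc ez; have [[cc _] _] := mc.
  have [w [l [win l1 wl]]] := cycle_points_near cc zc ez.
  have ow := minimal_cycle_odd_loop v_adj G2_even thinK mc win.
  have [q [qk oq wq]] := odd_loop_walkn ow wl.
  by exists q; split=> //; clear -qk l1; rewrite /k; lia.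
have [[p [pp lp] szp] [q [qp lq] szq]] := (wm, wn).
have wpq : is_walk a b (p ++ q) by split; rewrite ?cat_path ?last_cat lp ?pp.
have minpq l : walkn l a b -> size (p ++ q) <= l.
  by rewrite size_cat szp szq; exact: minmn.
(* The two walks meeting at [u] concatenate to a discrete geodesic with [u] at position [size p]. *)
have [fb fadj fgeo] := shortest_walk_geodesic wpq minpq.
have uE : nth a (a :: p ++ q) (size p) = u.
  by rewrite -cat_cons nth_cat ltnSn -lp -[size p]/(size (a :: p)).-1 nth_last.
have := odd_loop_geodesic v_adj G2_even thinK fadj fgeo (loop _ _ _ _ _ mC1 xC1 ex).
rewrite fb => /(_ (size p) (loop _ _ _ _ _ mC2 yC2 ey)).
rewrite uE size_cat leq_addr => /(_ isT) /(@odd_loop_near_minimal R).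
move=> /(le_trans far); rewrite lee_fin ler_nat; clear; lia.
Qed.
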